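(* Let $F$ be a field of positive characteristic $p$ and let $G$ be a group such that the group algebra $FG$ is modular. Let $V(FG)$ be the group of normalized units of $FG$, and let $V_*(FG)$ be the unitary subgroup of $V(FG)$ under the classical involution $*$ of $FG$. Then the following conditions are equivalent: (i) $V(FG)$ is locally nilpotent; (ii) $V_*(FG)$ is locally nilpotent; (iii) $G$ is locally nilpotent and the commutator subgroup $G'$ of $G$ is a $p$-group.
   Context: The group $G$ may be infinite. The group algebra $FG$ over a field $F$ of characteristic $p>0$ is called modular if $G$ contains an element of order $p$. The group of normalized units is $V(FG)=\{u=\sum_{g\in G}\alpha_g g \in FG : u \text{ is a unit of } FG,\ \sum_{g\in G}\alpha_g=1\}$, i.e. the units of augmentation $1$. The classical involution of $FG$ is the $F$-linear map $*$ given by $\left(\sum_{g\in G}\alpha_g g\right)^*=\sum_{g\in G}\alpha_g g^{-1}$. The unitary subgroup is $V_*(FG)=\{u\in V(FG) : u^*=u^{-1}\}$. A group is locally nilpotent if each of its finitely generated subgroups is nilpotent. A $p$-group is a (possibly infinite, possibly trivial) group in which every element has order a power of $p$. *)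

(* Defs.v *)
From HB Require Import structures.
From mathcomp Require Import all_boot all_algebra.
From mathcomp Require Import finmap.
From mathcomp.multinomials Require Import monalg.

Set Implicit Arguments.
Unset Strict Implicit.
Unset Printing Implicit Defensive.

Import GRing.Theory.

Local Open Scope fset_scope.
Local Open Scope ring_scope.

(* Subsets of a possibly infinite group are Prop-valued predicates. *)
Section InfiniteGroups.
Local Open Scope group_scope.
Context {G : groupType}.
Implicit Types (S H K : G -> Prop) (x y : G).

Inductive gen S : G -> Prop :=
| gen_in x : S x -> gen S x
| gen1 : gen S 1
| genM x y : gen S x -> gen S y -> gen S (x * y)
| genV x : gen S x -> gen S x^-1.

Definition commutator H K : G -> Prop :=
  gen (fun z => exists x y, [/\ H x, K y & z = [~ x, y]]).

(* lcs H n is the (n+1)-st term of the lower central series of H *)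
Fixpoint lcs H (n : nat) : G -> Prop :=
  if n is m.+1 then commutator (lcs H m) H else H.

Definition nilpotent_sub H : Prop := exists n, forall x, lcs H n x -> x = 1.

Definition has_order x (n : nat) : Prop :=
  [/\ (0 < n)%N, x ^+ n = 1 & forall m, (0 < m < n)%N -> x ^+ m <> 1].

Definition p_subgroup (p : nat) H : Prop :=
  forall x, H x -> exists k, has_order x (p ^ k)%N.

End InfiniteGroups.

Definition derived (G : groupType) : G -> Prop :=
  commutator (fun _ => True) (fun _ => True).
Arguments derived : clear implicits.

Definition locally_nilpotent (G : groupType) : Prop :=
  forall s : seq G, nilpotent_sub (gen (fun x => x \in s)).

(* Finitely supported functions G -> F with the convolution product.  The ring
   structure of monalg is not available here, since the axioms of monomType
   exclude nontrivial invertible elements; an alias receives the new one. *)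
Definition galg (F : fieldType) (G : groupType) : Type := {malg F[G]}.

HB.instance Definition _ (F : fieldType) (G : groupType) :=
  GRing.Lmodule.on (galg F G).

Section GroupAlgebra.
Context {F : fieldType} {G : groupType}.
Implicit Types (u v w : {malg F[G]}) (g h : G) (c d : F).

Definition galg_one : {malg F[G]} := << 1%g >>.

Definition galg_mul u v : {malg F[G]} :=
  \sum_(g <- msupp u) \sum_(h <- msupp v) << u@_g * v@_h *g (g * h)%g >>.

Lemma galg_mulEw (d1 d2 : {fset G}) u v :
  msupp u `<=` d1 -> msupp v `<=` d2 ->
  galg_mul u v = \sum_(g <- d1) \sum_(h <- d2) << u@_g * v@_h *g (g * h)%g >>.
Proof.
move=> le1 le2; rewrite /galg_mul (big_fset_incl _ le1) /=.
  apply/eq_bigr=> g _; apply/big_fset_incl => // h _ /mcoeff_outdom ->.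
  by rewrite mulr0 monalgU0.
move=> g _ /mcoeff_outdom ug.
by rewrite big1 // => h _; rewrite ug mul0r monalgU0.
Qed.

Lemma galg_mulDl : left_distributive galg_mul +%R.
Proof.
move=> u v w.
rewrite (galg_mulEw (msuppD_le u v) (fsubset_refl (msupp w))).
rewrite (galg_mulEw (fsubsetUl (msupp u) (msupp v)) (fsubset_refl (msupp w))).
rewrite (galg_mulEw (fsubsetUr (msupp u) (msupp v)) (fsubset_refl (msupp w))).
rewrite -big_split /=; apply/eq_bigr=> g _.
rewrite -big_split /=; apply/eq_bigr=> h _.
by rewrite mcoeffD mulrDl monalgUD.
Qed.

Lemma galg_mulDr : right_distributive galg_mul +%R.
Proof.
move=> w u v.
rewrite (galg_mulEw (fsubset_refl (msupp w)) (msuppD_le u v)).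
rewrite (galg_mulEw (fsubset_refl (msupp w)) (fsubsetUl (msupp u) (msupp v))).
rewrite (galg_mulEw (fsubset_refl (msupp w)) (fsubsetUr (msupp u) (msupp v))).
rewrite -big_split /=; apply/eq_bigr=> g _.
rewrite -big_split /=; apply/eq_bigr=> h _.
by rewrite mcoeffD mulrDr monalgUD.
Qed.

Lemma galg_mul0l : left_zero 0 galg_mul.
Proof. by move=> u; rewrite /galg_mul msupp0 big_seq_fset0. Qed.

Lemma galg_mul0r : right_zero 0 galg_mul.
Proof.
by move=> u; rewrite /galg_mul msupp0 big1 // => g _; rewrite big_seq_fset0.
Qed.

Lemma galg_mulUU c d g h :
  galg_mul << c *g g >> << d *g h >> = << c * d *g (g * h)%g >>.
Proof. by rewrite (galg_mulEw msuppU_le msuppU_le) !big_seq_fset1 !mcoeffUU. Qed.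

Lemma galg_mulUg c g v :
  galg_mul << c *g g >> v = \sum_(h <- msupp v) << c * v@_h *g (g * h)%g >>.
Proof.
rewrite (galg_mulEw msuppU_le (fsubset_refl _)) big_seq_fset1.
by apply/eq_bigr => h _; rewrite mcoeffUU.
Qed.

Lemma galg_mulgU c h u :
  galg_mul u << c *g h >> = \sum_(g <- msupp u) << u@_g * c *g (g * h)%g >>.
Proof.
rewrite (galg_mulEw (fsubset_refl _) msuppU_le).
by apply/eq_bigr => g _; rewrite big_seq_fset1 mcoeffUU.
Qed.

Lemma galg_mul_suml I (r : seq I) (f : I -> {malg F[G]}) v :
  galg_mul (\sum_(i <- r) f i) v = \sum_(i <- r) galg_mul (f i) v.
Proof.
exact: (big_morph (galg_mul^~ v) (fun _ _ => galg_mulDl _ _ _) (galg_mul0l _)).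
Qed.

Lemma galg_mul_sumr I (r : seq I) (f : I -> {malg F[G]}) u :
  galg_mul u (\sum_(i <- r) f i) = \sum_(i <- r) galg_mul u (f i).
Proof.
exact: (big_morph (galg_mul u) (fun _ _ => galg_mulDr _ _ _) (galg_mul0r _)).
Qed.

Lemma galg_mulA : associative galg_mul.
Proof.
move=> u v w; rewrite [u]monalgE !galg_mul_suml; apply/eq_bigr=> g _.
rewrite [v]monalgE galg_mul_sumr !galg_mul_suml galg_mul_sumr.
apply/eq_bigr=> h _; rewrite [w]monalgE !galg_mul_sumr; apply/eq_bigr=> k _.
by rewrite !galg_mulUU mulrA mulgA.
Qed.

Lemma galg_mul1l : left_id galg_one galg_mul.
Proof.
move=> u; rewrite galg_mulUg [RHS]monalgE.
by apply/eq_bigr=> g _; rewrite mul1r mul1g.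
Qed.

Lemma galg_mul1r : right_id galg_one galg_mul.
Proof.
move=> u; rewrite galg_mulgU [RHS]monalgE.
by apply/eq_bigr=> g _; rewrite mulr1 mulg1.
Qed.

Lemma galg_one_neq0 : galg_one != 0.
Proof. by rewrite monalgU_eq0 oner_eq0. Qed.

Lemma galg_scaleE c u : c *: u = galg_mul << c *g 1%g >> u.
Proof.
rewrite galg_mulUg malgZ_def.
by apply/eq_bigr=> g _; rewrite mul1g.
Qed.

Lemma galg_scaleAl c u v : c *: galg_mul u v = galg_mul (c *: u) v.
Proof. by rewrite !galg_scaleE galg_mulA. Qed.

Lemma galg_scaleAr c u v : c *: galg_mul u v = galg_mul u (c *: v).
Proof.
rewrite galg_scaleAl; apply/esym; rewrite !galg_scaleE galg_mulA; congr galg_mul.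
rewrite galg_mulUg galg_mulgU.
by apply/eq_bigr=> g _; rewrite mulrC mul1g mulg1.
Qed.

HB.instance Definition _ := GRing.Zmodule_isNzRing.Build (galg F G)
  galg_mulA galg_mul1l galg_mul1r galg_mulDl galg_mulDr galg_one_neq0.
HB.instance Definition _ :=
  GRing.Lmodule_isLalgebra.Build F (galg F G) galg_scaleAl.
HB.instance Definition _ :=
  GRing.Lalgebra_isAlgebra.Build F (galg F G) galg_scaleAr.

Lemma galg_mulE (u v : galg F G) :
  u * v = \sum_(g <- msupp u) \sum_(h <- msupp v)
            (<< u@_g * v@_h *g (g * h)%g >> : galg F G).
Proof. by []. Qed.

Definition augmentation (u : galg F G) : F := \sum_(g <- msupp u) u@_g.

Lemma augmentationEw (d : {fset G}) (u : galg F G) :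
  msupp u `<=` d -> augmentation u = \sum_(g <- d) u@_g.
Proof. by move=> le; apply: big_fset_incl => // g _ /mcoeff_outdom. Qed.

Lemma augmentation_is_zmod_morphism : zmod_morphism augmentation.
Proof.
move=> u v; rewrite (augmentationEw (msuppB_le u v)).
rewrite (augmentationEw (fsubsetUl (msupp u) (msupp v))).
rewrite (augmentationEw (fsubsetUr (msupp u) (msupp v))).
by rewrite -sumrB; apply/eq_bigr=> g _; rewrite mcoeffB.
Qed.

HB.instance Definition _ := GRing.isZmodMorphism.Build (galg F G) F
  augmentation augmentation_is_zmod_morphism.

Lemma augmentationU c g : augmentation << c *g g >> = c.
Proof. by rewrite (augmentationEw msuppU_le) big_seq_fset1 mcoeffUU. Qed.

Lemma augmentation_is_monoid_morphism : GRing.monoid_morphism augmentation.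
Proof.
split=> [|u v]; first exact: augmentationU.
rewrite [RHS]big_distrlr galg_mulE (raddf_sum augmentation); apply/eq_bigr=> g _.
by rewrite (raddf_sum augmentation); apply/eq_bigr=> h _; apply: augmentationU.
Qed.

HB.instance Definition _ := GRing.isMonoidMorphism.Build (galg F G) F
  augmentation augmentation_is_monoid_morphism.

Definition star (u : galg F G) : galg F G :=
  \sum_(g <- msupp u) << u@_g *g g^-1%g >>.

Lemma mcoeff_star (u : galg F G) g : (star u)@_g = u@_(g^-1)%g.
Proof.
rewrite [RHS](congr1 (mcoeff _) (monalgE u)) (raddf_sum (mcoeff g)).
rewrite (raddf_sum (mcoeff g^-1)%g); apply/eq_bigr=> h _ /=.
by rewrite !mcoeffU; congr (_ *+ (_ : bool)); apply/eqP/eqP => [<-|->];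
  rewrite invgK.
Qed.

Lemma star_is_linear : linear star.
Proof.
by move=> c u v; apply/malgP=> g; rewrite mcoeff_star !(mcoeffD, mcoeffZ)
  !mcoeff_star.
Qed.

HB.instance Definition _ := GRing.isLinear.Build F (galg F G) (galg F G) _
  star star_is_linear.

Lemma starU c g : star << c *g g >> = << c *g g^-1%g >>.
Proof.
apply/malgP=> h; rewrite mcoeff_star !mcoeffU.
by congr (_ *+ (_ : bool)); apply/eqP/eqP => [->|<-]; rewrite invgK.
Qed.

Lemma star1 : star 1 = 1.
Proof. by rewrite starU invg1. Qed.

Lemma starM : {morph star : u v / u * v >-> v * u}.
Proof.
move=> u v; rewrite [RHS]galg_mul_suml.
under [RHS]eq_bigr => h _ do rewrite galg_mul_sumr.
rewrite exchange_big galg_mulE (raddf_sum star); apply/eq_bigr=> g _.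
rewrite (raddf_sum star); apply/eq_bigr=> h _ /=.
by rewrite galg_mulUU -invgM mulrC; apply: starU.
Qed.

Lemma starK : involutive star.
Proof. by move=> u; apply/malgP=> g; rewrite !mcoeff_star invgK. Qed.

End GroupAlgebra.

(* The unit group of an arbitrary ring: a unit is stored with its (unique)
   inverse, so that no decision procedure for invertibility is required. *)
Record units (R : nzRingType) := Units {
  units_pair : R * R;
  _ : (units_pair.1 * units_pair.2 == 1) && (units_pair.2 * units_pair.1 == 1)
}.

HB.instance Definition _ (R : nzRingType) := [isSub for @units_pair R].
HB.instance Definition _ (R : nzRingType) := [Choice of units R by <:].

Section Units.
Context {R : nzRingType}.
Implicit Types x y : units R.

Definition uval x : R := (units_pair x).1.
Definition uinv x : R := (units_pair x).2.

Lemma uvalK x : uval x * uinv x = 1.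
Proof. by have /andP[/eqP] := valP x. Qed.

Lemma uinvK x : uinv x * uval x = 1.
Proof. by have /andP[_ /eqP] := valP x. Qed.

Lemma uval_inj : injective uval.
Proof.
move=> x y exy; apply/val_inj; rewrite /= [LHS]surjective_pairing.
rewrite [RHS]surjective_pairing; congr (_, _); first exact: exy.
rewrite -[LHS]mulr1 -[X in _ * X](uvalK y) -exy mulrA.
by rewrite [X in X * _](uinvK x) mul1r.
Qed.

Fact units_one_subproof : ((1 : R) * 1 == 1) && ((1 : R) * 1 == 1).
Proof. by rewrite mulr1 eqxx. Qed.
Definition units_one := @Units R (1, 1) units_one_subproof.

Fact units_mul_subproof x y :
  (uval x * uval y * (uinv y * uinv x) == 1)
  && (uinv y * uinv x * (uval x * uval y) == 1).
Proof.
rewrite -mulrA [uval y * _]mulrA uvalK mul1r uvalK eqxx /=.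
by rewrite -mulrA [uinv x * _]mulrA uinvK mul1r uinvK.
Qed.
Definition units_mul x y :=
  @Units R (uval x * uval y, uinv y * uinv x) (units_mul_subproof x y).

Fact units_inv_subproof x :
  (uinv x * uval x == 1) && (uval x * uinv x == 1).
Proof. by rewrite uvalK uinvK eqxx. Qed.
Definition units_inv x := @Units R (uinv x, uval x) (units_inv_subproof x).

Fact units_mulA : associative units_mul.
Proof. by move=> x y z; apply: uval_inj; apply: mulrA. Qed.
Fact units_mul1 : left_id units_one units_mul.
Proof. by move=> x; apply: uval_inj; apply: mul1r. Qed.
Fact units_mulr1 : right_id units_one units_mul.
Proof. by move=> x; apply: uval_inj; apply: mulr1. Qed.
Fact units_mulV : left_inverse units_one units_inv units_mul.
Proof. by move=> x; apply: uval_inj; apply: uinvK. Qed.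
Fact units_mulrV : right_inverse units_one units_inv units_mul.
Proof. by move=> x; apply: uval_inj; apply: uvalK. Qed.

HB.instance Definition _ := isGroup.Build (units R)
  units_mulA units_mul1 units_mulr1 units_mulV units_mulrV.

Lemma uval1 : uval 1%g = 1. Proof. by []. Qed.
Lemma uvalM x y : uval (x * y)%g = uval x * uval y. Proof. by []. Qed.
Lemma uvalV x : uval x^-1%g = uinv x. Proof. by []. Qed.

End Units.

Section UnitSubgroups.
Context {F : fieldType} {G : groupType}.

Definition normalized : {pred units (galg F G)} :=
  [pred u | augmentation (uval u) == 1].

Definition unitary : {pred units (galg F G)} :=
  [pred u | (u \in normalized) && (star (uval u) == uval u^-1%g)].

Lemma normalizedE u : (u \in normalized) = (augmentation (uval u) == 1).
Proof. by []. Qed.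

Lemma unitaryE u :
  (u \in unitary) = (u \in normalized) && (star (uval u) == uval u^-1%g).
Proof. by []. Qed.

Fact normalized_group_closed : group_closed normalized.
Proof.
split=> [|u v]; rewrite !normalizedE; first by rewrite uval1 rmorph1.
move=> /eqP nu /eqP nv; rewrite uvalM rmorphM /= nu mul1r.
have := congr1 augmentation (uvalK v).
by rewrite rmorphM rmorph1 /= nv mul1r => ->.
Qed.

Fact unitary_group_closed : group_closed unitary.
Proof.
have [n1 nV] := normalized_group_closed; split=> [|u v].
  by rewrite unitaryE n1 invg1 uval1 star1 /=.
rewrite !unitaryE => /andP[nu /eqP su] /andP[nv /eqP sv].
rewrite (nV u v nu nv) invgM invgK !uvalM starM su -sv starK.
by rewrite eqxx.
Qed.

End UnitSubgroups.

Record normalized_units (F : fieldType) (G : groupType) := NormalizedUnit {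
  nunit_val : units (galg F G);
  _ : nunit_val \in normalized
}.

HB.instance Definition _ F G := [isSub for @nunit_val F G].
HB.instance Definition _ F G := [Choice of normalized_units F G by <:].
HB.instance Definition _ F G := SubChoice_isSubGroup.Build
  (units (galg F G)) normalized (normalized_units F G) normalized_group_closed.

Record unitary_units (F : fieldType) (G : groupType) := UnitaryUnit {
  unitary_val : units (galg F G);
  _ : unitary_val \in unitary
}.

HB.instance Definition _ F G := [isSub for @unitary_val F G].
HB.instance Definition _ F G := [Choice of unitary_units F G by <:].
HB.instance Definition _ F G := SubChoice_isSubGroup.Build
  (units (galg F G)) unitary (unitary_units F G) unitary_group_closed.

(* The group algebra of G over a field of characteristic p is modular. *)
Definition modular (p : nat) (G : groupType) : Prop :=
  exists g : G, has_order g p.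

(* Main.v *)
Require Import Defs.
From mathcomp Require Import all_boot all_algebra.
From mathcomp Require Import finmap.
From mathcomp.multinomials Require Import monalg.

Set Implicit Arguments.
Unset Strict Implicit.
Unset Printing Implicit Defensive.

Import GRing.Theory.

(** Condition (iii) makes the whole unit group locally nilpotent.  The supports
of finitely many units and of their inverses generate a nilpotent group H, and
A = FH is filtered by the ideals J k generated by the g - 1, for g an iterated
commutator of weight more than k in the generators of H.  A weight-k.+1
commutator t is central modulo J k.+1, and t - 1 is nilpotent as soon as t is a
commutator, because H' is a p-group and F has characteristic p.  Removing these
finitely many central nilpotent generators one at a time
([lie_power_nilpotent]) shows that the strong Lie powers of A, which start with
[A, A] inside J 1, reach 0 ([lie_power_trivial]).  They bound the lower central
series of the units, by [u, v] - 1 = u^-1 v^-1 ((u - 1) v - v (u - 1)).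
Conditions (i) and (ii) follow since they concern subgroups of the unit group.

Conversely, G embeds in V_* by its natural basis, so (ii) makes G locally
nilpotent and the p-elements of G form a subgroup ([p_eltM]); it remains to see
that every commutator [x, y] is a p-element.  Modularity yields an element c of
order p commuting with x and y ([order_p_centralising]).  With
E = 1 + c + ... + c^(p-1) one has E^2 = 0 and E^* = E, so that
w = 1 + (h - h^-1) E is a unitary unit whenever c commutes with h.  Such units
generate an abelian group of exponent p, in which the Engel condition against g
forces w to commute with some power r = g^(p^k) ([commute_power]).  Comparing
coefficients in w r = r w, either h^2 lies in <c>, or [h, r] or [h, r^p] lies
in <c>; in the last two cases [h, g] is a p-element ([p_eltR_root]).
Applying this dichotomy to (x, y), (y, x) and (x y, y) leaves the case where
x^2, y^2 and (x y)^2 all lie in <c>, and then so does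
[x, y] = x^-2 y^-2 (x y)^2. *)

(** * Subgroups and congruences in nilpotent groups *)

Section Subgroups.
Local Open Scope group_scope.
Context {G : groupType}.
Implicit Types (H N T : G -> Prop) (x y z : G).

Definition subgroup H :=
  [/\ H 1, forall x y, H x -> H y -> H (x * y) & forall x, H x -> H x^-1].

Definition normalises H N := forall x y, N x -> H y -> N (x ^ y).

Lemma gen_subgroup T : subgroup (gen T).
Proof. by split; [apply: gen1 | apply: genM | apply: genV]. Qed.

Lemma gen_min T H : subgroup H -> (forall x, T x -> H x) ->
  forall x, gen T x -> H x.
Proof.
case=> H1 HM HV TH x; elim=> {x} [x /TH||x y _ Hx _ Hy|x _ Hx] //.
  exact: HM.
exact: HV.
Qed.

Lemma subgroupX H x n : subgroup H -> H x -> H (x ^+ n).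
Proof.
case=> H1 HM _ Hx.
by elim: n => [|n IHn]; rewrite ?expg0 ?expgS //; apply: (HM).
Qed.

Lemma subgroupJ H x y : subgroup H -> H x -> H y -> H (x ^ y).
Proof. by case=> _ HM HV Hx Hy; apply: (HM); [apply: (HV) | apply: (HM)]. Qed.

Lemma subgroupR H x y : subgroup H -> H x -> H y -> H [~ x, y].
Proof.
move=> sH Hx Hy; have [_ HM HV] := sH.
by apply: (HM); [apply: (HV) | apply: subgroupJ].
Qed.

Lemma commMg x y z : [~ x * y, z] = [~ x, z] ^ y * [~ y, z].
Proof. by rewrite /commg /conjg !gnorm. Qed.

Lemma commgM x y z : [~ x, y * z] = [~ x, z] * [~ x, y] ^ z.
Proof. by rewrite /commg /conjg !gnorm. Qed.

Lemma commVg x z : [~ x^-1, z] = ([~ x, z] ^ x^-1)^-1.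
Proof. by rewrite /commg /conjg !gnorm. Qed.

End Subgroups.

Section LowerCentralSeries.
Local Open Scope group_scope.
Context {G : groupType} (H : G -> Prop) (sH : subgroup H).
Implicit Types (x y : G).

Lemma lcs_subgroup n : subgroup (lcs H n).
Proof. by case: n => [|n] //=; apply: gen_subgroup. Qed.

Lemma lcsR n x y : lcs H n x -> H y -> lcs H n.+1 [~ x, y].
Proof. by move=> Hx Hy; apply: gen_in; exists x, y. Qed.

Lemma lcsS n x : lcs H n.+1 x -> lcs H n x.
Proof.
elim: n x => [|n IHn] x.
  apply: gen_min => [|{x} _ [x [y [Hx Hy ->]]]] //.
  exact: subgroupR.
apply: gen_min => [|{x} _ [x [y [Hx Hy ->]]]]; first exact: lcs_subgroup.
by apply: lcsR => //; apply: IHn.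
Qed.

Lemma lcs_sub n x : lcs H n x -> H x.
Proof. by elim: n => // n IHn /lcsS. Qed.

Lemma lcsJ n : normalises H (lcs H n).
Proof.
move=> x y Hx Hy; have [_ HM _] := lcs_subgroup n.
have -> : x ^ y = x * [~ x, y] by rewrite /commg /conjg !gnorm.
by apply: (HM) => //; apply: lcsS; apply: lcsR.
Qed.

End LowerCentralSeries.

Section Congruence.
Local Open Scope group_scope.
Context {G : groupType} (H N : G -> Prop).
Hypotheses (sH : subgroup H) (sN : subgroup N) (nHN : normalises H N).
Implicit Types (x y z : G).

(** Congruence modulo N replaces the quotient H / N, which would need N to be
a decidable predicate. *)
Definition cong x y := N (x^-1 * y).

Lemma cong_refl x : cong x x.
Proof. by rewrite /cong mulVg; case: sN. Qed.

Lemma cong_trans y x z : cong x y -> cong y z -> cong x z.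
Proof.
by case: sN => _ NM _ xy yz; have := NM _ _ xy yz; rewrite /cong !gnorm.
Qed.

Lemma congM x x' y y' : cong x x' -> cong y y' -> H y' ->
  cong (x * y) (x' * y').
Proof.
case: sN => _ NM _ xx' yy' Hy'; have := NM _ _ yy' (nHN xx' Hy').
by rewrite /cong /conjg !gnorm.
Qed.

Lemma congX x y n : cong x y -> H y -> cong (x ^+ n) (y ^+ n).
Proof.
move=> xy Hy; elim: n => [|n IHn]; first exact: cong_refl.
by rewrite !expgSr; apply: congM.
Qed.

Lemma cong_mem x y : cong x y -> N x <-> N y.
Proof.
case: sN => _ NM NV xy; split=> [Nx|Ny].
  by rewrite -(mulVKg x y); apply: (NM).
by have := NM _ _ Ny (NV _ xy); rewrite invgM invgK mulgA mulgV mul1g.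
Qed.

(** Modulo N, the commutator [b, a] commutes with a, so that conjugation by a
multiplies b by a fixed element that it leaves in place. *)
Lemma cong_commgX a b n : H a -> H b -> N [~ b, a, a] ->
  cong ([~ b, a] ^+ n) [~ b, a ^+ n].
Proof.
move=> Ha Hb dN; have Hd : H [~ b, a] by apply: subgroupR.
elim: n => [|n IHn]; first by rewrite commg1; apply: cong_refl.
rewrite expgS [a ^+ _]expgSr commgM.
have HR : H [~ b, a ^+ n] by apply: subgroupR => //; apply: subgroupX.
apply: congM; [exact: cong_refl | | exact: subgroupJ].
apply: (@cong_trans (([~ b, a] ^+ n) ^ a)); last first.
  by rewrite /cong -conjVg -conjMg; apply: nHN.
by rewrite conjXg; apply: congX => //; apply: subgroupJ.
Qed.

Lemma cong_expMn u v n : H u -> H v -> N [~ v, u] ->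
  cong (u ^+ n * v ^+ n) ((u * v) ^+ n).
Proof.
move=> Hu Hv vu; have [_ HM HV] := sH; have HX m w := @subgroupX _ _ w m sH.
elim: n => [|n IHn]; first by rewrite !expg0 mulg1; apply: cong_refl.
rewrite [(u * v) ^+ n.+1]expgSr.
apply: cong_trans (congM IHn (cong_refl (u * v)) (HM _ _ Hu Hv)).
rewrite !expgSr -!mulgA; apply: congM; first exact: cong_refl; last first.
  by apply: (HM); [apply: HX | apply: (HM)].
rewrite !mulgA; apply: congM => //; last exact: cong_refl.
rewrite [v ^+ n * u]conjgC; apply: congM; first exact: cong_refl; last first.
  by apply: subgroupJ => //; apply: HX.
by rewrite conjXg; apply: congX => //; apply: subgroupJ.
Qed.

End Congruence.

(** * Elements of p-power order in locally nilpotent groups *)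

Section Torsion.
Local Open Scope group_scope.
Context {G : groupType} (p : nat).
Implicit Types (H N T : G -> Prop) (x y z : G).

Definition p_elt x := exists k, x ^+ (p ^ k)%N = 1.

(** The image of gen T modulo N is abelian, so that its elements of p-power
order form a subgroup. *)
Lemma gen_torsion H N T : subgroup H -> subgroup N -> normalises H N ->
    (forall x, gen T x -> H x) ->
    (forall x y, gen T x -> gen T y -> N [~ x, y]) ->
    (forall x, T x -> exists k, N (x ^+ (p ^ k)%N)) ->
  forall x, gen T x -> exists k, N (x ^+ (p ^ k)%N).
Proof.
move=> sH sN nHN TH TN Tp x; have [N1 NM NV] := sN.
elim=> {x} [x /Tp //||x y Tx [k Nx] Ty [l Ny]|x Tx [k Nx]].
- by exists 0%N.
- exists (k + l)%N; set n := (p ^ _)%N.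
  have xy := cong_expMn sH sN nHN n (TH _ Tx) (TH _ Ty) (TN _ _ Ty Tx).
  apply/(cong_mem sN xy).
  rewrite /n; apply: (NM); first by rewrite expnD expgnA; apply: subgroupX.
  by rewrite addnC expnD expgnA; apply: subgroupX.
- by exists k; rewrite expVgn; apply: (NV).
Qed.

(** If a^q is one step deeper in the series, then [b, a]^q is congruent to
[b, a^q], which is one step deeper than [b, a]. *)
Lemma lcs_torsion H : subgroup H ->
    (forall x, H x -> exists k, lcs H 1 (x ^+ (p ^ k)%N)) ->
  forall n x, lcs H n x -> exists k, lcs H n.+1 (x ^+ (p ^ k)%N).
Proof.
move=> sH H1; elim=> [|n IHn] //.
have sN := lcs_subgroup sH n.+2; have nN := lcsJ sH (n := n.+2).
apply: (gen_torsion sH sN nN) => [x Hx | x y Hx Hy | _ [a [b [Ha Hb ->]]]].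
- exact: (lcs_sub sH (n := n.+1)).
- by apply: lcsR => //; apply: (lcs_sub sH (n := n.+1)).
have [k ak] := IHn a Ha; exists k.
have Hba : lcs H n.+1 [~ b, a].
  by rewrite -invgR; case: (lcs_subgroup sH n.+1) => _ _; apply; apply: lcsR.
have Ha' := lcs_sub sH Ha.
rewrite -invgR expVgn; have [_ _ NV] := sN; apply: (NV).
apply/(cong_mem sN (cong_commgX sH sN nN _ Ha' Hb (lcsR Hba Ha'))).
by rewrite -invgR; apply: (NV); apply: lcsR.
Qed.

Lemma lcs_p_elt H : subgroup H -> nilpotent_sub H ->
    (forall x, H x -> exists k, lcs H 1 (x ^+ (p ^ k)%N)) ->
  forall x, H x -> p_elt x.
Proof.
move=> sH [n Hn] H1 x Hx.
suff [k /Hn xk] : exists k, lcs H n (x ^+ (p ^ k)%N) by exists k.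
elim: n {Hn} => [|n [k xk]]; first by exists 0%N.
have [l xl] := lcs_torsion sH H1 xk; exists (k + l)%N.
by rewrite expnD expgnA.
Qed.

Lemma p_eltX x n : p_elt x -> p_elt (x ^+ n).
Proof. by case=> k xk; exists k; rewrite expgnAC xk expg1n. Qed.

Lemma p_eltV x : p_elt x -> p_elt x^-1.
Proof. by case=> k xk; exists k; rewrite expVgn xk invg1. Qed.

Lemma p_eltJ x y : p_elt x -> p_elt (x ^ y).
Proof. by case=> k xk; exists k; rewrite -conjXg xk conj1g. Qed.

Lemma p_elt_root x k : p_elt (x ^+ (p ^ k)%N) -> p_elt x.
Proof. by case=> l xl; exists (k + l)%N; rewrite expnD expgnA. Qed.

Lemma has_orderP x : prime p -> p_elt x <-> exists k, has_order x (p ^ k)%N.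
Proof.
move=> pr_p; split; last by case=> k []; exists k.
case=> k0 xk0; have ex : exists k, x ^+ (p ^ k)%N == 1 by exists k0; apply/eqP.
have [k /eqP xk kmin] := ex_minnP ex; exists k; split=> //.
  by rewrite expn_gt0 prime_gt0.
move=> m /andP[m0 mk] xm.
(* An exponent m < p^k would give the exponent gcd(m, p^k) = p^j with j < k,
   against the minimality of k. *)
have xg : x ^+ gcdn m (p ^ k) = 1.
  have [u v Euv _] := egcdnP (p ^ k) m0.
  have := congr1 (natexp x) Euv.
  rewrite expgnDr [(u * m)%N]mulnC [(v * _)%N]mulnC !expgnA xm xk !expg1n.
  by rewrite mul1g.
have /(dvdn_pfactor _ _ pr_p)[j jk Ej] := dvdn_gcdr m (p ^ k).
rewrite Ej in xg; have /kmin kj : x ^+ (p ^ j)%N == 1 by apply/eqP.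
have Ejk : j = k by apply/eqP; rewrite eqn_leq jk.
have : (p ^ k <= m)%N by rewrite -Ejk -Ej dvdn_leq ?dvdn_gcdl.
by rewrite leqNgt mk.
Qed.

Hypothesis nilG : locally_nilpotent G.

(** All lower central factors of the group generated by x and y are p-torsion as
soon as its abelianisation is. *)
Lemma p_eltM x y : p_elt x -> p_elt y -> p_elt (x * y).
Proof.
move=> px py; set T := fun z => z \in [:: x; y].
have sT : subgroup (gen T) by apply: gen_subgroup.
have [Tx Ty] : gen T x /\ gen T y.
  by split; apply: gen_in; rewrite /T !inE eqxx ?orbT.
apply: (lcs_p_elt sT (nilG _)); last by apply: genM.
apply: (gen_torsion sT) => //.
- exact: (lcs_subgroup sT 1).
- exact: (lcsJ sT (n := 1)).
- by move=> *; apply: lcsR.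
move=> z; rewrite /T !inE => zxy.
have [k zk] : p_elt z by case/orP: zxy => /eqP ->.
by exists k; rewrite zk; case: (lcs_subgroup sT 1).
Qed.

Lemma p_elt_subgroup : subgroup p_elt.
Proof.
by split; [exists 0%N; rewrite expg1n | apply: p_eltM | apply: p_eltV].
Qed.

Lemma engel x y : exists n, iter n (fun z => [~ z, y]) x = 1.
Proof.
have [n Tn] := nilG [:: x; y]; exists n; apply: Tn.
elim: n => [|n IHn]; first by apply: gen_in; rewrite !inE eqxx.
by rewrite iterS; apply: lcsR => //; apply: gen_in; rewrite !inE eqxx orbT.
Qed.

(** Uniqueness of p-th roots in a nilpotent group, modulo the p-elements: by
induction along the Engel sequence of x, the commutator [x, y] commutes with y
modulo p-elements, and then [x, y]^q is congruent to [x, y^q]. *)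
Lemma p_eltR_root x y k : p_elt [~ x, y ^+ (p ^ k)%N] -> p_elt [~ x, y].
Proof.
have sM := p_elt_subgroup; have [M1 MM MV] := sM.
have sT : subgroup (fun _ : G => True) by [].
have nM : normalises (fun=> True) p_elt by move=> z t /p_eltJ.
set q := (p ^ k)%N; pose Z z := p_elt [~ z, y ^+ q].
have sZ : subgroup Z.
  rewrite /Z; split=> [|a b Za Zb|a Za]; first by rewrite comm1g.
    by rewrite commMg; apply: (MM) => //; apply: p_eltJ.
  by rewrite commVg; apply: (MV); apply: p_eltJ.
have Zy : Z y by rewrite /Z commgXg.
move=> Zx; have [n] := engel x y.
elim: n x Zx => [|n IHn] x Zx; first by move=> /= ->; rewrite comm1g.
rewrite iterSr => /(IHn _ (subgroupR sZ Zx Zy)) xyy.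
have /p_elt_root// : p_elt ([~ x, y] ^+ q).
exact/(cong_mem sM (cong_commgX sT sM nM q I I xyy)).
Qed.

(** One step down the Engel sequence costs one more factor p.  If [w, y]
commutes with v = y^(p^k), so does [w, v], which is a product of conjugates of
[w, y] by powers of y; hence [w, v^p] = [w, v]^p = 1. *)
Lemma commute_power (B : G -> Prop) w y :
    (forall u, B u -> u ^+ p = 1) -> (forall u n, B u -> B [~ u, y ^+ n]) ->
  B w -> exists k, commute w (y ^+ (p ^ k)%N).
Proof.
move=> Bp BR Bw; have [n] := engel w y.
elim: n w Bw => [|n IHn] w Bw.
  by move=> /= ->; exists 0%N; apply/commute_sym/commute1.
rewrite iterSr => /(IHn _ (BR w 1%N Bw))[k].
set v := y ^+ (p ^ k)%N => wyv.
have wv m : commute [~ w, y ^+ m] v.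
  elim: m => [|m IHm]; first by rewrite commg1; apply/commute_sym/commute1.
  rewrite expgSr commgM; apply/commute_sym/commuteM; first exact: commute_sym.
  apply/commgP; rewrite -[v in [~ v, _]](_ : v ^ y = v); last first.
    apply/conjg_fixP/commgP; exact/commute_sym/commuteX/commute_refl.
  by rewrite -conjRg conjg_eq1; apply/commgP/commute_sym.
exists k.+1; apply/commgP/eqP; rewrite expnSr expgnA -/v.
have s1 : subgroup (fun u : G => u = 1).
  by split=> // [_ _ -> ->|_ ->]; rewrite ?mulg1 ?invg1.
have n1 : normalises (fun=> True) (fun u : G => u = 1).
  by move=> _ z -> _; rewrite conj1g.
have sT : subgroup (fun _ : G => True) by [].
have /eqP vv : [~ w, v, v] == 1 by apply/commgP/wv.
apply/(cong_mem s1 (cong_commgX sT s1 n1 p I I vv)); exact/Bp/BR.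
Qed.

(** Commuting z repeatedly with x and y stays among p-elements and descends the
lower central series, so the last nontrivial commutator obtained commutes with
both; a power of it has order p. *)
Lemma order_p_centralising x y z : z != 1 -> p_elt z ->
  exists c, [/\ c != 1, c ^+ p = 1, commute c x & commute c y].
Proof.
move=> z1 pz; have [n Kn] := nilG [:: x; y; z].
set K := gen _ in Kn; have sK : subgroup K by apply: gen_subgroup.
have [Kx Ky Kz] : [/\ K x, K y & K z].
  by split; apply: gen_in; rewrite !inE eqxx ?orbT.
have [_ MM MV] := p_elt_subgroup.
have [c [c1 [k ck] cx cy]] :
    exists c, [/\ c != 1, p_elt c, commute c x & commute c y].
  have pR a b : p_elt a -> p_elt [~ a, b].
    by move=> pa; apply: (MM); [apply: (MV) | apply: p_eltJ].
  suff: forall j i u, (i + j = n)%N -> lcs K i u -> u != 1 -> p_elt u ->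
      exists c, [/\ c != 1, p_elt c, commute c x & commute c y].
    by move/(_ n 0%N z); apply.
  elim=> [|j IHj] i u ij Ku u1 pu.
    by rewrite addn0 in ij; rewrite ij in Ku; rewrite (Kn _ Ku) eqxx in u1.
  have [ux|ux] := eqVneq [~ u, x] 1; last first.
    by apply: IHj ux (pR _ _ pu); [rewrite -ij -addSnnS | apply: lcsR].
  have [uy|uy] := eqVneq [~ u, y] 1; last first.
    by apply: IHj uy (pR _ _ pu); [rewrite -ij -addSnnS | apply: lcsR].
  by exists u; split=> //; apply/commgP/eqP.
elim: k c c1 ck cx cy => [|k IHk] c c1 ck cx cy.
  by rewrite expg1 in ck; rewrite ck eqxx in c1.
have [cp|cp] := eqVneq (c ^+ p) 1; first by exists c.
have X u : commute c u -> commute (c ^+ p) u.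
  by move=> cu; apply/commute_sym/commuteX/commute_sym.
by apply: (IHk _ cp); [rewrite -expgnA -expnS | apply: X | apply: X].
Qed.

End Torsion.
(** * Strong Lie powers of a subring *)

Section RelativeIdeals.
Local Open Scope ring_scope.
Context {R : nzRingType}.
Implicit Types (A I L X : R -> Prop) (a b x y z t : R).

(** Subrings and their ideals are predicates, because the group algebra of a
finitely generated subgroup H of G is studied inside that of G. *)
Definition subring A :=
  [/\ A 1, forall x y, A x -> A y -> A (x - y)
    & forall x y, A x -> A y -> A (x * y)].

Definition rel_ideal A I :=
  [/\ I 0, forall x y, I x -> I y -> I (x + y),
      forall a x, A a -> I x -> I (a * x) & forall a x, A a -> I x -> I (x * a)].

Inductive ideal A X : R -> Prop :=
| ideal0 : ideal A X 0
| idealD x y : ideal A X x -> ideal A X y -> ideal A X (x + y)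
| ideal_gen a x b : A a -> X x -> A b -> ideal A X (a * x * b).

Lemma ideal_rel_ideal A X : subring A -> rel_ideal A (ideal A X).
Proof.
case=> _ _ AM; split; first exact: ideal0; first exact: idealD.
  move=> a x Aa; elim=> {x} [|x y _ Ix _ Iy|b x c Ab Xx Ac].
  - by rewrite mulr0; apply: ideal0.
  - by rewrite mulrDr; apply: idealD.
  - by rewrite !mulrA; apply: ideal_gen => //; apply: AM.
move=> a x Aa; elim=> {x} [|x y _ Ix _ Iy|b x c Ab Xx Ac].
- by rewrite mul0r; apply: ideal0.
- by rewrite mulrDl; apply: idealD.
- by rewrite -mulrA; apply: ideal_gen => //; apply: AM.
Qed.

Lemma ideal_in A X x : subring A -> X x -> ideal A X x.
Proof.
by case=> A1 _ _ Xx; rewrite -[x]mul1r -[_ * x]mulr1; apply: ideal_gen.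
Qed.

Lemma ideal_min A X I : rel_ideal A I -> (forall x, X x -> I x) ->
  forall x, ideal A X x -> I x.
Proof.
case=> I0 ID IMl IMr XI x; elim=> {x} [|x y _ Ix _ Iy|a x b Aa Xx Ab] //.
  exact: ID.
by apply: (IMr) => //; apply: (IMl) => //; apply: XI.
Qed.

(** The strong Lie powers: each term is an ideal of A, not merely the additive
span of the Lie commutators. *)
Fixpoint lie_power A n : R -> Prop :=
  if n is m.+1 then
    ideal A (fun z => exists x y, [/\ lie_power A m x, A y & z = x * y - y * x])
  else A.

Context (A : R -> Prop) (sA : subring A).

Lemma subring0 : A 0.
Proof. by have [A1 AB _] := sA; rewrite -(subrr 1); apply: AB. Qed.

Lemma subringN x : A x -> A (- x).
Proof.
by have [_ AB _] := sA; rewrite -sub0r; apply: AB => //; apply: subring0.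
Qed.

Lemma subringD x y : A x -> A y -> A (x + y).
Proof.
by have [_ AB _] := sA => Ax /subringN; rewrite -{2}[y]opprK; apply: AB.
Qed.

Lemma subringX x n : A x -> A (x ^+ n).
Proof.
have [A1 _ AM] := sA => Ax.
by elim: n => [|n IHn]; rewrite ?expr0 ?exprS //; apply: AM.
Qed.

Lemma subring_rel_ideal : rel_ideal A A.
Proof.
have [_ _ AM] := sA; split=> // [|x y|a x Aa Ax].
- exact: subring0.
- exact: subringD.
- exact: AM.
Qed.

Lemma rel_idealN I x : rel_ideal A I -> I x -> I (- x).
Proof.
case=> _ _ IM _ Ix; rewrite -mulN1r; apply: IM => //.
by apply: subringN; case: sA.
Qed.

Lemma rel_idealB I x y : rel_ideal A I -> I x -> I y -> I (x - y).
Proof. by move=> iI Ix /(rel_idealN iI); case: iI => _ ID _ _; apply: ID. Qed.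

Lemma lie_power_ideal n : rel_ideal A (lie_power A n).
Proof.
by case: n => [|n]; [apply: subring_rel_ideal | apply: ideal_rel_ideal].
Qed.

Lemma lie_power_sub n x : lie_power A n x -> A x.
Proof.
have [_ AB AM] := sA; elim: n x => [|n IHn] x //.
apply: ideal_min => [|{x} _ [x [y [/IHn Ax Ay ->]]]].
  exact: subring_rel_ideal.
by apply: AB; apply: AM.
Qed.

Lemma lie_powerR n x y : lie_power A n x -> A y ->
  lie_power A n.+1 (x * y - y * x).
Proof. by move=> Lx Ay; apply: (ideal_in sA); exists x, y. Qed.

Definition add_mul I t L x := exists y z, [/\ I y, L z & x = y + t * z].

Lemma add_mul_ideal I t L : rel_ideal A I -> rel_ideal A L ->
    (forall z, L z -> A z) -> (forall a, A a -> I (t * a - a * t)) ->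
  rel_ideal A (add_mul I t L).
Proof.
move=> iI [L0 LD LMl LMr] LA tI; have [I0 ID IMl IMr] := iI; split.
- by exists 0, 0; rewrite mulr0 addr0.
- move=> _ _ [y [z [Iy Lz ->]]] [y' [z' [Iy' Lz' ->]]].
  exists (y + y'), (z + z'); split; [exact: ID | exact: LD |].
  by rewrite mulrDr addrACA.
- move=> a _ Aa [y [z [Iy Lz ->]]].
  exists (a * y - (t * a - a * t) * z), (a * z); split; [| exact: LMl |].
    by apply: rel_idealB => //; [apply: IMl | apply: IMr (LA _ Lz) (tI _ Aa)].
  by rewrite mulrDr mulrBl opprB !mulrA -addrA subrK.
- move=> a _ Aa [y [z [Iy Lz ->]]]; exists (y * a), (z * a).
  by split; [exact: IMr | exact: LMr | rewrite mulrDl mulrA].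
Qed.

Lemma central_expr I t j a : rel_ideal A I -> A t ->
    (forall a, A a -> I (t * a - a * t)) -> A a ->
  I (t ^+ j * a - a * t ^+ j).
Proof.
move=> [I0 ID IMl IMr] At tI Aa; elim: j => [|j IHj].
  by rewrite mul1r mulr1 subrr.
have -> : t ^+ j.+1 * a - a * t ^+ j.+1
    = t * (t ^+ j * a - a * t ^+ j) + (t * a - a * t) * t ^+ j.
  by rewrite mulrBr mulrBl exprS !mulrA addrA subrK.
by apply: ID; [apply: IMl | apply: IMr (tI _ Aa); apply: subringX].
Qed.

(** Since t commutes with A modulo I, Lie commutation acts on t^j z through z
alone.  Hence the Lie power of index j * n + i lies in I + t^j L, with L the
one of index i, and the choice j = m makes t disappear. *)
Lemma lie_power_nilpotent I t m n : rel_ideal A I -> A t ->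
    (forall a, A a -> I (t * a - a * t)) -> I (t ^+ m) ->
    (forall x, lie_power A n x -> add_mul I t A x) ->
  forall x, lie_power A (m * n) x -> I x.
Proof.
move=> iI At tI tm Ln; have [I0 ID IMl IMr] := iI.
suff main j i x :
    lie_power A (j * n + i) x -> add_mul I (t ^+ j) (lie_power A i) x.
  move=> x; rewrite -[(m * n)%N]addn0 => /main[y [z [Iy Az ->]]].
  by apply: ID => //; apply: IMr.
elim: j i x => [|j IHj] i x.
  by move=> Lx; exists 0, x; split=> //; rewrite mul1r add0r.
elim: i x => [|i IHi] x.
  rewrite addn0 mulSn addnC => /IHj[y [z [Iy /Ln[y' [z' [Iy' Az' ->]]] ->]]].
  exists (y + t ^+ j * y'), z'; split=> //.
    by apply: ID => //; apply: IMl => //; apply: subringX.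
  by rewrite mulrDr addrA mulrA exprSr.
have tjI a (Aa : A a) := central_expr j.+1 iI At tI Aa.
rewrite addnS.
apply: ideal_min => [|{x} _ [x [b [/IHi[y [z [Iy Lz ->]]] Ab ->]]]].
  apply: add_mul_ideal => //; first exact: lie_power_ideal.
  exact: lie_power_sub.
set T := t ^+ j.+1.
exists (y * b - b * y + (T * b - b * T) * z), (z * b - b * z); split.
- apply: ID; first by apply: rel_idealB => //; [apply: IMr | apply: IMl].
  by apply: IMr; [apply: lie_power_sub Lz | apply: tjI].
- exact: lie_powerR.
- rewrite mulrDl mulrDr mulrBr mulrBl !mulrA opprD [LHS]addrACA -[RHS]addrA.
  by congr (_ + _); rewrite [RHS]addrC addrA subrK.
Qed.

(** For u = [x, y] the identity u - 1 = x^-1 y^-1 ((x - 1) y - y (x - 1)) gains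
one Lie power. *)
Lemma lcs_lie_power (s : seq (units R)) :
    (forall u, u \in s -> A (uval u) /\ A (uinv u)) ->
  forall n u, lcs (gen (fun u => u \in s)) n u -> lie_power A n (uval u - 1).
Proof.
move=> sU; set U := gen _; have [A1 AB AM] := sA.
have UA u : U u -> A (uval u) /\ A (uinv u).
  elim=> {u} [u /sU||u v _ [Au Au'] _ [Av Av']|u _ [Au Au']] //.
  by split; apply: (AM).
have sU' : subgroup U := gen_subgroup _.
elim=> [|n IHn] u; first by move=> /UA[Au _]; apply: AB.
pose P v := U v /\ lie_power A n.+1 (uval v - 1).
suff: lcs U n.+1 u -> P u by move=> h /h[].
have [L0 LD LMl LMr] := lie_power_ideal n.+1; have [U1 UM UV] := sU'.
apply: (@gen_min _ _ P) => [|_ [x [y [Ux Uy ->]]]].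
  split.
  - by split=> //; rewrite uval1 subrr.
  - move=> v w [Ux Lx] [Uy Ly]; split; first exact: UM.
    rewrite uvalM -[_ * _ - 1](subrKA (uval w)) -{2}[uval w]mul1r -mulrBl.
    by apply: LD => //; apply: LMr => //; case: (UA w Uy).
  - move=> x [Ux Lx]; split; first exact: UV.
    rewrite uvalV -[_ - 1]opprB; apply: (rel_idealN (lie_power_ideal _)).
    rewrite -{1}(uinvK x) -{2}[uinv x]mulr1 -mulrBr.
    by apply: LMl => //; case: (UA _ Ux).
have UUx := lcs_sub sU' Ux; split; first exact: subgroupR.
have [[Ax Ax'] [Ay Ay']] := (UA _ UUx, UA _ Uy).
have -> : uval [~ x, y]%g - 1 = uinv x * uinv y
    * ((uval x - 1) * uval y - uval y * (uval x - 1)).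
  rewrite [(_ - 1) * _]mulrBl [uval y * (_ - 1)]mulrBr mul1r mulr1 opprB.
  rewrite addrA subrK mulrBr.
  rewrite -[uinv x * uinv y * (uval y * _)]mulrA.
  rewrite [uinv y * (uval y * _)]mulrA uinvK mul1r uinvK.
  by rewrite /commg /conjg !uvalM !uvalV mulrA.
by apply: LMl; [apply: AM | apply: lie_powerR => //; apply: IHn].
Qed.

End RelativeIdeals.
(** * Group algebras of nilpotent groups whose commutators are p-elements *)

Section Basis.
Local Open Scope ring_scope.
Context {F : fieldType} {G : groupType}.
Implicit Types (g h t : G) (u : galg F G).

Definition basis g : galg F G := << 1 *g g >>.

Lemma basis1 : basis 1%g = 1. Proof. by []. Qed.

Lemma basisM g h : basis (g * h)%g = basis g * basis h.
Proof. by rewrite -[RHS]/(galg_mul _ _) galg_mulUU mulr1. Qed.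

Lemma basisX g n : basis (g ^+ n)%g = basis g ^+ n.
Proof.
by elim: n => [|n IHn]; rewrite ?basis1 // expgS exprS basisM IHn.
Qed.

Lemma basisVK g : basis g^-1%g * basis g = 1.
Proof. by rewrite -basisM mulVg. Qed.

Lemma basisKV g : basis g * basis g^-1%g = 1.
Proof. by rewrite -basisM mulgV. Qed.

Lemma basis_commE g h : basis g * basis h - basis h * basis g
  = basis h * basis g * (basis [~ g, h]%g - 1).
Proof. by rewrite mulrBr mulr1 -!basisM -commgC. Qed.

Lemma galg_basisE u : u = \sum_(g <- msupp u) u@_g *: basis g.
Proof.
rewrite {1}[u]monalgE; apply: eq_bigr => g _; apply/malgP => h.
by rewrite mcoeffZ !mcoeffU mulrnAr mulr1.
Qed.

End Basis.

Section Span.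
Local Open Scope ring_scope.
Context {F : fieldType} {G : groupType}.
Implicit Types (H S : G -> Prop) (g h t : G) (a b u : galg F G).

Inductive span H : galg F G -> Prop :=
| span0 : span H 0
| spanD a b : span H a -> span H b -> span H (a + b)
| span_scale c g : H g -> span H (c *: basis g).

Lemma span_basis H g : H g -> span H (basis g).
Proof. by move=> Hg; rewrite -[basis g]scale1r; apply: span_scale. Qed.

Lemma span_supp H u : (forall g, g \in msupp u -> H g) -> span H u.
Proof.
rewrite {2}[u]galg_basisE => Hu.
suff main (s : seq G) : (forall g, g \in s -> H g) ->
  span H (\sum_(g <- s) u@_g *: basis g) by apply: main.
elim: s {Hu} => [|g s IHs] Hs.
  by rewrite big_nil; apply: span0.
rewrite big_cons; apply: spanD.
  by apply: span_scale; apply: Hs; rewrite mem_head.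
by apply: IHs => h hs; apply: Hs; rewrite inE hs orbT.
Qed.

Lemma span_subring H : subgroup H -> subring (span H).
Proof.
case=> H1 HM _.
have spanZ c a : span H a -> span H (c *: a).
  elim=> {a} [|a b _ Ha _ Hb|d g Hg]; first by rewrite scaler0; apply: span0.
    by rewrite scalerDr; apply: spanD.
  by rewrite scalerA; apply: span_scale.
split=> [|a b Ha Hb|a b Ha Hb]; first exact: span_basis.
  by apply: spanD => //; rewrite -scaleN1r; apply: spanZ.
elim: Ha => {a} [|a a' _ IHa _ IHa'|c g Hg].
  by rewrite mul0r; apply: span0.
  by rewrite mulrDl; apply: spanD.
rewrite -scalerAl; apply: spanZ.
elim: Hb => {b} [|b b' _ IHb _ IHb'|d h Hh].
  by rewrite mulr0; apply: span0.
  by rewrite mulrDr; apply: spanD.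
by rewrite -scalerAr -basisM; apply: span_scale; apply: HM.
Qed.

(** The g such that basis g commutes with b modulo I form a subgroup. *)
Lemma span_comm S (A := span (gen S)) I b : rel_ideal A I -> A b ->
    (forall g, S g -> I (basis g * b - b * basis g)) ->
  forall a, A a -> I (a * b - b * a).
Proof.
move=> iI Ab SI; have [I0 ID IMl IMr] := iI.
have sA : subring A by apply: span_subring; apply: gen_subgroup.
have [_ _ AM] := sA.
have gI g : gen S g -> I (basis g * b - b * basis g).
  elim=> {g} [g /SI||g h Sg Ig Sh Ih|g Sg Ig] //.
  - by rewrite basis1 mul1r mulr1 subrr.
  - have -> : basis (g * h)%g * b - b * basis (g * h)%g
        = basis g * (basis h * b - b * basis h)
          + (basis g * b - b * basis g) * basis h.
      by rewrite mulrBr mulrBl basisM !mulrA addrA subrK.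
    by apply: ID; [apply: IMl | apply: IMr] => //; apply: span_basis.
  - have Ag' : A (basis g^-1%g) by apply/span_basis/genV.
    have -> : basis g^-1%g * b - b * basis g^-1%g
        = - (basis g^-1%g * (basis g * b - b * basis g) * basis g^-1%g).
      rewrite mulrBr mulrBl opprB !mulrA basisVK mul1r.
      by rewrite -[_ * basis g * _]mulrA basisKV mulr1.
    by apply: (rel_idealN sA iI); apply: IMr => //; apply: IMl.
move=> a; elim=> {a} [|a a' _ Ia _ Ia'|c g Hg].
- by rewrite mul0r mulr0 subrr.
- by rewrite mulrDl mulrDr opprD addrACA; apply: ID.
have Ac : A (c *: 1) by rewrite -basis1; apply/span_scale/gen1.
rewrite -scalerAl -scalerAr -scalerBr -[_ - _]mul1r scalerAl.
by apply: IMl => //; apply: gI.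
Qed.

End Span.

Section UnitsNilpotent.
Local Open Scope ring_scope.
Context {F : fieldType} {p : nat} {G : groupType} (charF : p \in [pchar F]).

(** The Frobenius map is additive on commuting elements. *)
Lemma basis_sub1X g k :
  (basis g - 1) ^+ (p ^ k) = basis (g ^+ (p ^ k))%g - 1 :> galg F G.
Proof.
have charA : p \in [pchar (galg F G)] by rewrite (pchar_lalg (galg F G)).
elim: k => [|k IHk]; first by rewrite expn0 expr1 expg1.
rewrite expnSr exprM IHk -(pFrobenius_autE charA).
rewrite pFrobenius_autB_comm; last exact: commr1.
by rewrite pFrobenius_aut1 pFrobenius_autE -basisX -expgnA.
Qed.

Fixpoint weight_comms (S : seq G) n : seq G :=
  if n is m.+1 then [seq [~ x, y]%g | x <- weight_comms S m, y <- S] else S.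

Context (S : seq G) (nilS : nilpotent_sub (gen (fun g => g \in S))).
Hypothesis pS : forall x y, p_elt p [~ x, y : G]%g.

Let U := gen (fun g => g \in S).
Let sU : subgroup U := gen_subgroup _.
Let A : galg F G -> Prop := span U.
Let sA : subring A. Proof. exact/span_subring/gen_subgroup. Qed.

Let deep k (g : G) := exists2 j, (k <= j)%N & g \in weight_comms S j.
Let J k := ideal A (fun z => exists2 g, deep k g & z = basis g - 1).
Let iJ k : rel_ideal A (J k) := ideal_rel_ideal _ sA.

Lemma weight_comms_lcs k g : g \in weight_comms S k -> lcs U k g.
Proof.
elim: k g => [|k IHk] g; first exact: gen_in.
case/allpairsP => [[x y] /= [/IHk Ux Sy ->]].
by apply: lcsR => //; apply: gen_in.
Qed.

Lemma weight_comms_span k g : g \in weight_comms S k -> A (basis g).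
Proof.
move=> /weight_comms_lcs Ug; apply: span_basis.
exact (lcs_sub sU Ug).
Qed.

(** For a generator y, t y - y t = y t ([t, y] - 1), and [t, y] has weight one
more than t. *)
Lemma weight_comms_central k t : t \in weight_comms S k ->
  forall a, A a -> J k.+1 (basis t * a - a * basis t).
Proof.
move=> Tt a Aa; rewrite -opprB; apply: (rel_idealN sA (iJ _)).
apply: span_comm Aa => //; first exact: weight_comms_span Tt.
move=> y Sy; rewrite -opprB; apply: (rel_idealN sA (iJ _)).
have [_ _ IMl _] := iJ k.+1; have [_ _ AM] := sA.
rewrite basis_commE; apply: IMl.
  by apply: AM; [apply/span_basis/gen_in | apply: weight_comms_span Tt].
apply: ideal_in => //; exists [~ t, y]%g => //; exists k.+1 => //.
by apply/allpairsP; exists (t, y).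
Qed.

Lemma lie_power_level0 x : lie_power A 1 x -> J 1 x.
Proof.
apply: ideal_min => [|_ [a [b [Aa Ab ->]]]]; first exact: iJ.
apply: span_comm Aa => // g Sg.
exact: (@weight_comms_central 0).
Qed.

(** Commutators t of weight k.+1 are removed one after the other: each t - 1 is
central modulo the ideal of deeper commutators, and nilpotent because t, being
a commutator when k > 0, has p-power order. *)
Lemma lie_power_levelS k n : (0 < k)%N ->
    (forall x, lie_power A n x -> J k x) ->
  exists m, forall x, lie_power A m x -> J k.+1 x.
Proof.
move=> k0 Ln; have pT t : t \in weight_comms S k -> p_elt p t.
  by case: k k0 {Ln} => // k _ /allpairsP[[x y] [_ _ ->]].
(* K r adds to J k.+1 the generators of weight k.+1 that are still to be
   removed. *)
pose K (r : seq G) :=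
  ideal A (fun z => exists2 g, g \in r \/ deep k.+1 g & z = basis g - 1).
have iK r : rel_ideal A (K r) by apply: ideal_rel_ideal.
have K0 x : K [::] x -> J k.+1 x.
  apply: ideal_min => // _ [g [//|Dg] ->].
  by apply: ideal_in => //; exists g.
suff main (r : seq G) : {subset r <= weight_comms S k} -> forall n,
    (forall x, lie_power A n x -> K r x) ->
    exists m, forall x, lie_power A m x -> J k.+1 x.
  apply: (main (weight_comms S k)) => // x /Ln.
  apply: ideal_min => // _ [g [j kj Tg] ->].
  apply: (ideal_in sA); exists g => //.
  move: kj Tg; rewrite leq_eqVlt => /orP[/eqP <- | kj] Tg; first by left.
  by right; exists j.
elim: r => [|t r IHr] rT n' Ln'; first by exists n' => x /Ln'/K0.
have Tt : t \in weight_comms S k by apply: rT; rewrite mem_head.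
have JK x : J k.+1 x -> K r x.
  apply: ideal_min => // _ [g Dg ->]; apply: ideal_in => //; exists g => //.
  by right.
have [e te] := pT _ Tt.
have [A1 AB AM] := sA.
have At : A (basis t - 1) by apply: AB => //; apply: weight_comms_span Tt.
have tK a : A a -> K r ((basis t - 1) * a - a * (basis t - 1)).
  move=> Aa; apply: JK; rewrite mulrBl mulrBr mul1r mulr1 opprB addrA subrK.
  exact: weight_comms_central.
have [K0' KD KMl KMr] := iK r.
apply: (IHr _ (p ^ e * n')%N) => [g gr|].
  by apply: rT; rewrite inE gr orbT.
apply: (lie_power_nilpotent sA (iK r) At tK) => [|x /Ln'].
  by rewrite basis_sub1X te basis1 subrr.
apply: ideal_min => [|_ [g gtr ->]].
  apply: add_mul_ideal => //; exact: subring_rel_ideal.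
have [->|gt] := eqVneq g t.
  by exists 0, 1; rewrite mulr1 add0r.
exists (basis g - 1), 0; split; last by rewrite mulr0 addr0.
  apply: ideal_in => //; exists g => //.
  by case: gtr => [|Dg]; [rewrite inE (negbTE gt); left | right].
exact: subring0.
Qed.

Lemma lie_power_trivial : exists n, forall x, lie_power A n x -> x = 0.
Proof.
have [c Uc] := nilS.
have [n Ln] : exists n, forall x, lie_power A n x -> J c.+1 x.
  elim: c {Uc} => [|c [n Ln]]; first by exists 1%N; apply: lie_power_level0.
  exact: lie_power_levelS Ln.
exists n => x /Ln; apply: (@ideal_min _ A _ (fun z => z = 0)).
  by split=> // [_ _ -> ->|a _ _ ->|a _ _ ->]; rewrite ?addr0 ?mulr0 ?mul0r.
move=> _ [g [j cj /weight_comms_lcs Ug] ->].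
suff -> : g = 1%g by rewrite basis1 subrr.
apply: Uc; elim: j cj Ug => // j IHj; rewrite leq_eqVlt => /orP[/eqP[->] Ug|].
  exact (lcsS sU Ug).
by move=> cj Ug; apply: IHj (lcsS sU Ug).
Qed.

End UnitsNilpotent.

Lemma units_locally_nilpotent (F : fieldType) p (G : groupType) :
    p \in [pchar F]%R -> locally_nilpotent G ->
    (forall x y : G, p_elt p [~ x, y]%g) ->
  locally_nilpotent (units (galg F G)).
Proof.
move=> charF nilG pG s.
pose supp (u : galg F G) : seq G := enum_fset (msupp u).
pose S := flatten [seq supp (uval u) ++ supp (uinv u) | u <- s].
have [n Ln] := lie_power_trivial charF (nilG S) pG.
exists n => u /(lcs_lie_power _) h; apply: uval_inj; apply/eqP.
rewrite -GRing.subr_eq0; apply/eqP; apply: Ln; apply: h.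
  exact/span_subring/gen_subgroup.
move=> v vs; split; apply: span_supp => g gv; apply: gen_in; apply/flatten_mapP;
by exists v; rewrite // mem_cat gv ?orbT.
Qed.
(** * Embeddings of groups and the unitary units of group elements *)

Section Embedding.
Local Open Scope group_scope.
Context {K L : groupType} (f : K -> L).
Hypotheses (fM : {morph f : x y / x * y}) (f_inj : injective f).

Lemma locally_nilpotent_inj : locally_nilpotent L -> locally_nilpotent K.
Proof.
have f1 : f 1 = 1 by apply: (mulgI (f 1)); rewrite -fM !mulg1.
have fV : {morph f : x / x^-1}.
  by move=> x; apply: (mulgI (f x)); rewrite -fM !mulgV.
have gen_image (T : K -> Prop) (T' : L -> Prop) :
    (forall x, T x -> T' (f x)) -> forall x, gen T x -> gen T' (f x).
  move=> TT' x; elim=> {x} [x /TT'||x y _ Tx _ Ty|x _ Tx].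
  - exact: gen_in.
  - by rewrite f1; apply: gen1.
  - by rewrite fM; apply: genM.
  - by rewrite fV; apply: genV.
move=> nilL s; have [n Ln] := nilL (map f s); exists n => x Kx.
apply: f_inj; rewrite f1; apply: Ln.
elim: n x Kx => [|n IHn]; first by apply: (gen_image) => x; apply: map_f.
apply: (gen_image) => _ [x [y [Kx Ky ->]]].
exists (f x), (f y); split; first exact: IHn.
  by apply: (gen_image) Ky => z; apply: map_f.
by rewrite /commg /conjg !(fM, fV).
Qed.

End Embedding.

Section UnitaryEmbedding.
Local Open Scope ring_scope.
Context {F : fieldType} {G : groupType}.
Implicit Types (g h : G) (u v : unitary_units F G).

Definition vval u : galg F G := uval (unitary_val u).

Lemma vval_inj : injective vval.
Proof. by move=> u v /uval_inj/val_inj. Qed.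

Lemma vvalM u v : vval (u * v)%g = vval u * vval v.
Proof. by []. Qed.

Lemma vvalVK u : vval u^-1%g * vval u = 1.
Proof. by rewrite -vvalM mulVg. Qed.

Lemma vvalX u n : vval (u ^+ n)%g = vval u ^+ n.
Proof. by elim: n => [|n IHn] //; rewrite expgS exprS vvalM IHn. Qed.

Lemma unitary_exists a b : a * b = 1 -> b * a = 1 -> augmentation a = 1 ->
  star a = b -> exists u, vval u = a.
Proof.
move=> ab ba aug_a sa.
have eab : (a * b == 1) && (b * a == 1) by rewrite ab ba eqxx.
have ua : @Units (galg F G) (a, b) eab \in unitary.
  by rewrite unitaryE normalizedE /uval /= aug_a sa eqxx /=.
by exists (UnitaryUnit ua).
Qed.

Fact unitary_basis_subproof g :
  (basis g * basis g^-1%g == 1 :> galg F G)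
  && (basis g^-1%g * basis g == 1 :> galg F G).
Proof. by rewrite basisKV basisVK eqxx. Qed.

Fact unitary_basis_unitary g :
  @Units (galg F G) (basis g, basis g^-1%g) (unitary_basis_subproof g)
    \in unitary.
Proof. by rewrite unitaryE normalizedE /uval /= augmentationU starU !eqxx. Qed.

Definition unitary_basis g : unitary_units F G :=
  UnitaryUnit (unitary_basis_unitary g).

Lemma vval_basis g : vval (unitary_basis g) = basis g. Proof. by []. Qed.

Lemma unitary_basisM : {morph unitary_basis : g h / (g * h)%g}.
Proof. by move=> g h; apply: vval_inj; rewrite vvalM !vval_basis basisM. Qed.

Lemma basis_inj : injective (@basis F G).
Proof.
move=> g h /(congr1 (mcoeff g)) /eqP; rewrite mcoeffUU mcoeffU.
by case: (h =P g) => // _; rewrite mulr0n oner_eq0.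
Qed.

Lemma group_locally_nilpotent :
  locally_nilpotent (unitary_units F G) -> locally_nilpotent G.
Proof.
apply: (@locally_nilpotent_inj _ _ unitary_basis unitary_basisM) => g h.
by move/(congr1 vval); apply: basis_inj.
Qed.

End UnitaryEmbedding.

(** * Unitary units attached to an element of order p *)

Section OrderPElement.
Local Open Scope ring_scope.
Context {F : fieldType} {p : nat} {G : groupType} (charF : p \in [pchar F]).
Context (c : G) (c1 : c != 1%g) (cp : (c ^+ p = 1)%g).
Implicit Types (g h : G) (u v : unitary_units F G) (a x : galg F G).

Definition cycle_sum : galg F G := \sum_(i < p) basis c ^+ i.
Local Notation E := cycle_sum.

Let pr_p : prime p := pcharf_prime charF.
Let charA : p \in [pchar (galg F G)].
Proof. by rewrite (pchar_lalg (galg F G)). Qed.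

Definition in_cycle g := [exists i : 'I_p, (c ^+ i)%g == g].

Lemma cycle_sumMl i : basis c ^+ i * E = E.
Proof.
elim: i => [|i IHi]; first by rewrite mul1r.
rewrite exprSr -mulrA; suff -> : basis c * E = E by [].
apply/eqP; rewrite -GRing.subr_eq0 -{2}[E]mul1r -mulrBl -subrX1.
by rewrite -basisX cp basis1 subrr.
Qed.

Lemma cycle_sum_sq : E * E = 0.
Proof.
rewrite {1}/cycle_sum mulr_suml; under eq_bigr do rewrite cycle_sumMl.
by rewrite sumr_const card_ord mulrn_pchar.
Qed.

Lemma cycle_sum_comm g : commute c g -> GRing.comm (basis g) E.
Proof.
move=> cg; apply: commr_sum => i _; apply: commrX.
by rewrite /GRing.comm -!basisM cg.
Qed.

(** The involution sends c^(p-1-i) to c^(i+1), and E absorbs the extra factor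
c. *)
Lemma star_cycle_sum : star E = E.
Proof.
rewrite -[RHS](cycle_sumMl 1) expr1 /cycle_sum raddf_sum mulr_sumr /=.
rewrite [RHS](reindex_inj rev_ord_inj) /=; apply: eq_bigr => i _.
rewrite -exprS -!basisX starU; congr basis.
rewrite subnSK //; apply: (mulgI (c ^+ i)%g).
by rewrite mulgV -expgnDr subnKC ?cp // ltnW.
Qed.

Lemma augmentation_cycle_sum : augmentation E = 0.
Proof.
rewrite raddf_sum (eq_bigr (fun=> 1)) /= => [|i _].
  by rewrite sumr_const card_ord (pcharf0 charF).
by rewrite -basisX augmentationU.
Qed.

(** The powers c^i with i < p are distinct, so E is the indicator function of
the cyclic group generated by c. *)
Lemma mcoeff_cycle_sum h g : (basis h * E)@_g = (in_cycle (h^-1 * g)%g)%:R.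
Proof.
rewrite mulr_sumr (raddf_sum (mcoeff g)) /=.
have cE (i : 'I_p) :
    (basis h * basis c ^+ i)@_g = ((c ^+ i)%g == (h^-1 * g)%g)%:R.
  rewrite -basisX -basisM mcoeffU; congr (_ *+ (_ : bool)).
  by apply/eqP/eqP => [<-|->]; rewrite (mulKg, mulVKg).
under eq_bigr do rewrite cE.
rewrite /in_cycle; case: existsP => [[i ci]|noi].
  rewrite (bigD1 i) //= ci big1 ?addr0 // => j ji; case: eqP => // cj.
  case/negP: ji; move: cj; rewrite -(eqP ci) => cj; apply/eqP/val_inj/eqP => /=.
  have ord (m n : nat) : (m < p)%N -> (n < m)%N -> (c ^+ m <> c ^+ n)%g.
    move=> mp nm; rewrite -(subnK (ltnW nm)) expgnDr => /(canRL (mulgK _)).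
    rewrite mulgV; set d := (m - n)%N => cd.
    have d0 : (0 < d)%N by rewrite subn_gt0.
    have dp : (d < p)%N by rewrite (leq_ltn_trans (leq_subr _ _)).
    have /eqP cop : coprime d p by rewrite coprime_sym prime_coprime // gtnNdvd.
    have [s t Est _] := egcdnP p d0; have := congr1 (natexp c) Est.
    rewrite cop expgnDr [(s * d)%N]mulnC [(t * p)%N]mulnC !expgnA cd cp !expg1n.
    by rewrite mul1g => /esym/eqP; apply/negP.
  case: ltngtP => // lt; first by have := ord _ _ (ltn_ord i) lt; rewrite cj.
  by have := ord _ _ (ltn_ord j) lt; rewrite cj.
by rewrite big1 // => i _; case: eqP => // ci; case: noi; exists i; apply/eqP.
Qed.

Lemma in_cycle_p_elt g : in_cycle g -> p_elt p g.
Proof.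
by case/existsP=> i /eqP <-; apply: p_eltX; exists 1%N; rewrite expn1.
Qed.

Lemma mul1DE a x : GRing.comm x E ->
  (1 + a * E) * (1 + x * E) = 1 + (a + x) * E.
Proof.
move=> xE; rewrite mulrDl mul1r mulrDr mulr1 -!mulrA [E * (_ * _)]mulrA -xE.
by rewrite -mulrA cycle_sum_sq !mulr0 addr0 mulrDl -addrA [x * E + _]addrC.
Qed.

(** This group is elementary abelian and normalised by every unitary unit that
commutes with E. *)
Definition cycle_unit u := exists2 x, GRing.comm x E & vval u = 1 + x * E.

Lemma cycle_unitX u : cycle_unit u -> (u ^+ p = 1)%g.
Proof.
case=> x xE ux; apply: vval_inj; rewrite vvalX ux -(pFrobenius_autE charA).
rewrite pFrobenius_autD_comm; last exact/commr_sym/commr1.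
rewrite pFrobenius_aut1 pFrobenius_autE -(subnKC (prime_gt1 pr_p)) exprD.
have -> : (x * E) ^+ 2 = 0.
  by rewrite expr2 -mulrA [E * (_ * _)]mulrA -xE -mulrA cycle_sum_sq !mulr0.
by rewrite mul0r addr0.
Qed.

Lemma cycle_unitR u v : GRing.comm (vval v) E -> GRing.comm (vval v^-1%g) E ->
  cycle_unit u -> cycle_unit [~ u, v]%g.
Proof.
move=> vE vE' [x xE ux].
have ux' : vval u^-1%g = 1 + (- x) * E.
  have := mul1DE (- x) xE; rewrite addNr mul0r addr0 -ux => h.
  have uu' : vval u * vval u^-1%g = 1 by rewrite -vvalM mulgV.
  have -> : vval u^-1%g = (1 + (- x) * E) * (vval u * vval u^-1%g).
    by rewrite mulrA h mul1r.
  by rewrite uu' mulr1.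
(* u^v = 1 + y E, and [u, v] = u^-1 u^v. *)
pose y := vval v^-1%g * x * vval v.
have yE : GRing.comm y E.
  by apply/commr_sym/commrM; [apply: commrM |]; apply: commr_sym.
exists (- x + y).
  by apply/commr_sym/commrD; [apply: commrN|]; apply: commr_sym.
rewrite -mul1DE // -ux' /commg /conjg !vvalM ux; congr (_ * _).
by rewrite mulrDl mulrDr mul1r vvalVK -!mulrA -vE !mulrA.
Qed.

Hypothesis nilV : locally_nilpotent (unitary_units F G).
Let nilG : locally_nilpotent G := group_locally_nilpotent nilV.

Lemma unitary_cycle_unit h : commute c h ->
  exists u, vval u = 1 + (basis h - basis h^-1%g) * E.
Proof.
move=> ch; set a := _ - _.
have aE : GRing.comm a E.
  apply/commr_sym/commrB; apply/commr_sym/cycle_sum_comm => //.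
  exact: commuteV.
have sa : star a = - a by rewrite raddfB /= !starU invgK opprB.
have NaE : GRing.comm (- a) E by apply/commr_sym/commrN/commr_sym.
apply: (@unitary_exists _ _ _ (1 + (- a) * E)).
- by rewrite mul1DE // subrr mul0r addr0.
- by rewrite mul1DE // addNr mul0r addr0.
- by rewrite rmorphD rmorphM rmorph1 /= augmentation_cycle_sum mulr0 addr0.
- by rewrite raddfD /= star1 starM star_cycle_sum sa NaE.
Qed.

(** Comparing coefficients at r h in w r = r w, where w = 1 + (h - h^-1) E and
r = g^q, gives [[r, h] in <c>] - [h^r h in <c>] = 1 - [h^2 in <c>] in F, with
Iverson brackets.  If h^2 is not in <c>, then either [r, h] is, or
h^r = c^i h^-1 and -1 = 1 in F; in this second case p = 2 and r^2 commutes with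
h. *)
Lemma sq_in_cycle_or_p_eltR h g : commute c h -> commute c g ->
  in_cycle (h ^+ 2)%g \/ p_elt p [~ h, g]%g.
Proof.
move=> ch cg; have [w wE] := unitary_cycle_unit ch.
have hE z : commute c z -> GRing.comm (basis z : galg F G) E.
  exact: cycle_sum_comm.
have Bw : cycle_unit w.
  exists (basis h - basis h^-1%g) => //.
  apply/commr_sym/commrB; apply/commr_sym/hE => //.
  exact: commuteV.
pose y := unitary_basis (F := F) g.
have yX n : (y ^+ n)%g = unitary_basis (g ^+ n)%g.
  by apply: vval_inj; rewrite vvalX !vval_basis basisX.
have yR u n : cycle_unit u -> cycle_unit [~ u, y ^+ n]%g.
  apply: cycle_unitR; rewrite yX; apply: hE; [|apply: commuteV];
  exact: commuteX.
have [k] := commute_power nilV cycle_unitX yR Bw.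
rewrite yX; set q := (p ^ k)%N; set r := (g ^+ q)%g.
have cr : commute c r by apply: commuteX.
move/(congr1 vval); rewrite !vvalM vval_basis wE mulrDl mulrDr mul1r mulr1.
move/addrI; rewrite -mulrA -(hE _ cr) !mulrA mulrBl mulrBr -!basisM !mulrBl.
move/(congr1 (mcoeff (r * h)%g)); rewrite !mcoeffB !mcoeff_cycle_sum.
have -> : in_cycle ((r * h)^-1 * (r * h))%g.
  by apply/existsP; exists (Ordinal (prime_gt0 pr_p)); rewrite mulVg.
have -> : ((r * h^-1)^-1 * (r * h) = h ^+ 2)%g by rewrite expg2 !gnorm.
have -> : ((h * r)^-1 * (r * h) = [~ r, h])%g by rewrite /commg /conjg !gnorm.
have -> : ((h^-1 * r)^-1 * (r * h) = h ^ r * h)%g by rewrite /conjg !gnorm.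
case: (in_cycle (h ^+ 2)%g); [by left | move=> eqE; right; move: eqE].
case rh : (in_cycle [~ r, h]%g).
  have /(p_eltR_root nilG)// : p_elt p [~ h, g ^+ (p ^ k)%N]%g.
  rewrite -invgR; apply: p_eltV; exact: in_cycle_p_elt.
case hrh : (in_cycle (h ^ r * h)%g); last first.
  by move/eqP; rewrite subrr subr0 eq_sym oner_eq0.
rewrite sub0r subr0 => /esym/eqP; rewrite -subr_eq0 opprK => two.
have p2 : p = 2.
  have two' : 2 \in [pchar F] by rewrite inE /=.
  by move: two'; rewrite (pcharf_eq charF) => /eqP.
have /existsP[i /eqP ci] := hrh.
have hr : (h ^ r = c ^+ i * h^-1)%g by rewrite ci mulgK.
have /(p_eltR_root nilG)// : p_elt p [~ h, g ^+ (p ^ k.+1)%N]%g.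
rewrite expnSr expgnA -/q -/r.
have -> : (r ^+ p = r ^+ 2)%g by rewrite p2.
exists 0%N; rewrite expg1; apply/eqP/conjg_fixP.
rewrite expg2 conjgM hr conjMg conjVg hr.
have cX z : commute c z -> commute (c ^+ i)%g z.
  by move=> cz; apply/commute_sym/commuteX/commute_sym.
have /conjg_fixP -> : [~ c ^+ i, r]%g == 1%g by apply/commgP/cX.
by rewrite invgM invgK mulgA cX // mulgK.
Qed.

(** If the squares of x, y and x y all lie in <c>, then x and y generate an
elementary abelian 2-group modulo <c>; otherwise one of the commutators
[x, y], [y, x] and [x y, y] = [x, y]^y is already a p-element. *)
Lemma p_eltR_centralised (x y : G) : commute c x -> commute c y ->
  p_elt p [~ x, y]%g.
Proof.
move=> cx cy; have [_ MM MV] := p_elt_subgroup p nilG.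
have [/in_cycle_p_elt px2|//] := sq_in_cycle_or_p_eltR cx cy.
have [y2|/p_eltV] := sq_in_cycle_or_p_eltR cy cx; last by rewrite invgR.
have cxy := commuteM cx cy.
have [/in_cycle_p_elt pxy2|] := sq_in_cycle_or_p_eltR cxy cy; last first.
  by rewrite commMg commgg mulg1 => /(p_eltJ y^-1%g); rewrite conjgK.
have y2x : commute x (y ^+ 2)^-1%g.
  apply: commuteV; have /existsP[i /eqP <-] := y2.
  exact/commuteX/commute_sym.
have -> : [~ x, y]%g = ((x ^+ 2)^-1 * ((y ^+ 2)^-1 * (x * y) ^+ 2))%g.
  rewrite [((x * y) ^+ 2)%g]expg2 -!mulgA [((y ^+ 2)^-1 * (x * _))%g]mulgA -y2x.
  by rewrite !expg2 /commg /conjg !gnorm.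
have py2 := in_cycle_p_elt y2.
by apply: (MM); [exact: MV | apply: (MM) => //; apply: (MV)].
Qed.

End OrderPElement.

Theorem mainTheorem1 (F : fieldType) (p : nat) (G : groupType)
    (charF : p \in [pchar F]%R) (modFG : modular p G) :
  (locally_nilpotent (normalized_units F G)
     <-> locally_nilpotent (unitary_units F G))
  /\ (locally_nilpotent (unitary_units F G)
     <-> locally_nilpotent G /\ p_subgroup p (derived G)).
Proof.
have pr_p := pcharf_prime charF.
have units_nil : locally_nilpotent G /\ p_subgroup p (derived G) ->
    locally_nilpotent (units (galg F G)).
  case=> nilG pG; apply: units_locally_nilpotent charF nilG _ => x y.
  by apply/(has_orderP _ pr_p)/pG/gen_in; exists x, y.
have to_unitary : locally_nilpotent (units (galg F G)) ->
    locally_nilpotent (unitary_units F G).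
  by apply: (@locally_nilpotent_inj _ _ val) => //; apply: val_inj.
have to_normalized : locally_nilpotent (units (galg F G)) ->
    locally_nilpotent (normalized_units F G).
  by apply: (@locally_nilpotent_inj _ _ val) => //; apply: val_inj.
have from_unitary : locally_nilpotent (unitary_units F G) ->
    locally_nilpotent G /\ p_subgroup p (derived G).
  move=> nilV; have nilG := group_locally_nilpotent nilV; split=> // g Gg.
  apply/(has_orderP _ pr_p); move: g Gg.
  apply: gen_min => [|_ [x [y [_ _ ->]]]]; first exact: p_elt_subgroup.
  have [z [_ zp z1]] := modFG.
  have [||c [c1 cp cx cy]] := @order_p_centralising _ p nilG x y z.
  - by apply/eqP; have := z1 1%N; rewrite expg1; apply; rewrite prime_gt1.
  - by exists 1%N; rewrite expn1.
  exact: (p_eltR_centralised charF c1 cp nilV).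
have normalized_of_unitary (u : unitary_units F G) : val u \in normalized.
  by have := valP u; rewrite unitaryE => /andP[].
split; [split=> [|/from_unitary/units_nil/to_normalized //] |].
  apply: (@locally_nilpotent_inj _ _
    (fun u => NormalizedUnit (normalized_of_unitary u))).
    by move=> u v; apply: val_inj.
  by move=> u v [/val_inj].
by split=> [/from_unitary|/units_nil/to_unitary].
Qed.
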